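(* Let $A=\bigoplus_{i\ge 0}A^i$ be a connected graded commutative finite dimensional algebra with unit over a field $\mathbf k$. Then the power series $\sum_{r\ge 1}\mathsf{zcl}_{r+1}(A)\cdot x^r$ is a rational function of the form $P(x)\cdot(1-x)^{-2}$, where $P(x)$ is a polynomial with integer coefficients satisfying $P(1)=\mathsf{cl}(A)$.
   Context: $A$ is connected if its degree zero part is $\mathbf k\cdot 1$, generated by the unit. The cup-length $\mathsf{cl}(A)$ is the largest number of elements of $A$ of positive degree (equivalently, homogeneous elements of positive degree) with nonzero product ($0$ if there are no nonzero elements of positive degree). For $r\ge 2$ let $A^{\otimes r}$ be the $r$-fold tensor product over $\mathbf k$, with multiplication using the sign rule $(a\otimes b)(a'\otimes b')=(-1)^{|a'||b|}aa'\otimes bb'$ for homogeneous elements, and let $\mu_r\colon A^{\otimes r}\to A$ be the algebra homomorphism $\mu_r(a_1\otimes\dots\otimes a_r)=a_1a_2\cdots a_r$. The $r$-th zero-divisors-cup-length $\mathsf{zcl}_r(A)$ is the largest number of elements of $\ker(\mu_r)$ with nonzero product in $A^{\otimes r}$ ($0$ if $\ker(\mu_r)=0$). *)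

(* Defs.v *)
From mathcomp Require Import all_boot all_order all_algebra all_field.
From mathcomp Require Import zify.

Set Implicit Arguments.
Unset Strict Implicit.
Unset Printing Implicit Defensive.

Import GRing.Theory.
Local Open Scope ring_scope.

(* A direct sum decomposition of A indexed by nat: every finite subfamily is in
   direct sum, and, A being finite dimensional, finitely many pieces fill A. *)
Record grading (k : fieldType) (A : falgType k) := Grading {
  gr :> nat -> {vspace A};
  gr_direct : forall n, directv (\sum_(i < n) gr i);
  gr_full : exists n, (\sum_(i < n) gr i == fullv)%VS;
  gr_one : 1 \in gr 0%N;
  gr_mul : forall i j a b, a \in gr i -> b \in gr j -> a * b \in gr (i + j)%N
}.

Section GradedAlgebra.

Context {k : fieldType} {A : falgType k}.
Implicit Types (G : grading A) (a b : A).

Definition graded_commutative G : Prop :=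
  forall i j a b, a \in G i -> b \in G j -> a * b = (-1) ^+ (i * j) * (b * a).

Definition connected G : Prop := G 0%N = <[1]>%VS.

Definition positive_degree G a : Prop := exists2 i, (0 < i)%N & a \in G i.

(* The least n such that A is the sum of the pieces of degree < n. *)
Definition degree_bound G : nat := ex_minn (gr_full G).

Definition hcomp G (i : 'I_(degree_bound G)) (a : A) : A :=
  sumv_pi (\sum_(j < degree_bound G) G j)%VS i a.

End GradedAlgebra.

(* m is the largest number of elements of K whose product (of a list, computed
   by prod) is nonzero.  The empty list is allowed: its product is the unit, so
   that the maximum is 0 when no nonempty product survives. *)
Definition longest_nonzero_product (T : nmodType) (K : T -> Prop)
    (prod : seq T -> T) (m : nat) : Prop :=
  (exists s : seq T,
     [/\ size s = m, forall z, z \in s -> K z & prod s != 0]) /\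
  (forall s : seq T,
     (forall z, z \in s -> K z) -> prod s != 0 -> (size s <= m)%N).

Definition is_cl (k : fieldType) (A : falgType k) (G : grading A) : nat -> Prop :=
  longest_nonzero_product (positive_degree G) (fun s => \prod_(a <- s) a).

Section TensorPower.

Context {k : fieldType} {A : falgType k}.
Implicit Types (G : grading A) (r : nat).

Local Notation n := (\dim {:A}).

(* The r-fold tensor power of A over k, as the space with basis the pure tensors
   e_(f 0) ⊗ ... ⊗ e_(f (r-1)), f : {ffun 'I_r -> 'I_n}, where e is the
   canonical basis of A; an element is the function giving its coordinates. *)
Definition tpow r : vectType k := {ffun {ffun 'I_r -> 'I_n} -> k^o}.

Definition tbasis r (f : {ffun 'I_r -> 'I_n}) : {ffun 'I_r -> A} :=
  [ffun i => (vbasis {:A})`_(f i)].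

(* The pure tensor a_0 ⊗ ... ⊗ a_(r-1). *)
Definition pure r (a : {ffun 'I_r -> A}) : tpow r :=
  [ffun f : {ffun 'I_r -> 'I_n} => \prod_i coord (vbasis {:A}) (f i) (a i)].

(* The linear map on A^{⊗r} induced by a multilinear F; see tlift_pure. *)
Definition tlift r (V : lmodType k) (F : {ffun 'I_r -> A} -> V) (x : tpow r) : V :=
  \sum_f (x f : k) *: F (tbasis f).

Definition tone r : tpow r := pure [ffun => 1].

(* Moving b_i of degree e i to the left past every a_j of degree d j with j > i. *)
Definition koszul r (d e : 'I_r -> nat) : nat :=
  (\sum_(i < r) \sum_(j < r | i < j) d j * e i)%N.

(* (a_0 ⊗ ...)(b_0 ⊗ ...), by splitting each a_i and b_i into its homogeneous
   components and applying the sign rule; see tmul_pure. *)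
Definition pure_mul G r (a b : {ffun 'I_r -> A}) : tpow r :=
  \sum_(d : {ffun 'I_r -> 'I_(degree_bound G)})
  \sum_(e : {ffun 'I_r -> 'I_(degree_bound G)})
    (-1) ^+ koszul (fun i => d i) (fun i => e i) *:
      pure [ffun i => hcomp (d i) (a i) * hcomp (e i) (b i)].

Definition tmul G r (x y : tpow r) : tpow r :=
  tlift (fun a => tlift (fun b => pure_mul G a b) y) x.

Definition tprod G r (s : seq (tpow r)) : tpow r := foldr (tmul G (r := r)) (tone r) s.

Definition mu r : tpow r -> A := tlift (fun a : {ffun 'I_r -> A} => \prod_(i < r) a i).

Definition upd r (a : {ffun 'I_r -> A}) (i : 'I_r) (u : A) : {ffun 'I_r -> A} :=
  [ffun j => if j == i then u else a j].

Definition multilinear r (V : lmodType k) (F : {ffun 'I_r -> A} -> V) : Prop :=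
  forall a i c u v, F (upd a i (c *: u + v)) = c *: F (upd a i u) + F (upd a i v).

Section Multilinear.

Variable r : nat.
Implicit Types (a b : {ffun 'I_r -> A}) (V : lmodType k).

Lemma upd_id a i : upd a i (a i) = a.
Proof. by apply/ffunP=> j; rewrite ffunE; case: eqP => [->|]. Qed.

Lemma multilinear_sum V (F : {ffun 'I_r -> A} -> V) a i I (s : seq I) (c : I -> k) (u : I -> A) :
  multilinear F ->
  F (upd a i (\sum_(j <- s) c j *: u j)) = \sum_(j <- s) c j *: F (upd a i (u j)).
Proof.
move=> Fl; elim: s => [|j s IHs]; last by rewrite !big_cons Fl IHs.
rewrite !big_nil; have := Fl a i 1 0 0; rewrite scaler0 addr0 scale1r.
by move/esym/eqP; rewrite -subr_eq0 addrK => /eqP.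
Qed.

Lemma multilinear_ext V (F F' : {ffun 'I_r -> A} -> V) :
  multilinear F -> multilinear F' -> (forall f, F (tbasis f) = F' (tbasis f)) ->
  F =1 F'.
Proof.
move=> Fl Fl' eqF a.
suff H m : (m <= r)%N -> forall a,
    (forall i : 'I_r, (m <= i)%N -> exists j : 'I_n, a i = (vbasis {:A})`_j) -> F a = F' a.
  by apply: (H r) => // i; rewrite leqNgt ltn_ord.
elim: m => [_ {}a aB|m IHm lt_mr {}a aB].
  have [f fE] : exists f : {ffun 'I_r -> 'I_n}, forall i, a i = (vbasis {:A})`_(f i).
    have aB' i : {j : 'I_n | a i == (vbasis {:A})`_j}.
      by apply/sigW; have [j ->] := aB i (leq0n _); exists j.
    by exists [ffun i => sval (aB' i)] => i; rewrite ffunE; exact/eqP/(svalP (aB' i)).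
  by have -> : a = tbasis f by apply/ffunP=> i; rewrite ffunE.
pose i0 := Ordinal lt_mr; rewrite -(upd_id a i0).
rewrite (coord_vbasis (memvf (a i0))) !multilinear_sum //.
apply: eq_bigr => j _; congr (_ *: _); apply: IHm => [|i le_mi]; first exact: ltnW.
rewrite ffunE; case: eqP => [_|/eqP ne_i]; first by exists j.
by apply: aB; rewrite ltn_neqAle le_mi andbT eq_sym.
Qed.

Lemma multilinear_pure : multilinear (@pure r).
Proof.
move=> a i c u v; apply/ffunP=> f; rewrite !ffunE /=.
have E w : \prod_j coord (vbasis {:A}) (f j) (upd a i w j) =
    coord (vbasis {:A}) (f i) w * \prod_(j < r | j != i) coord (vbasis {:A}) (f j) (a j).
  rewrite (bigD1 i) //= ffunE eqxx; congr (_ * _).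
  by apply: eq_bigr => j /negPf ne; rewrite ffunE ne.
by rewrite !E linearP mulrDl -mulrA.
Qed.

Lemma multilinear_mu : multilinear (fun a => \prod_(i < r) a i).
Proof.
move=> a i c u v.
have E w : \prod_(j < r) upd a i w j =
    \prod_(0 <= j < i) a (insubd i j) * w * \prod_(i.+1 <= j < r) a (insubd i j).
  have -> : \prod_(j < r) upd a i w j = \prod_(0 <= j < r) upd a i w (insubd i j).
    by rewrite big_mkord; apply: eq_bigr => j _; rewrite valKd.
  rewrite (big_cat_nat (n := i)) //= 1?ltnW // (big_ltn (ltn_ord i)).
  have -> : insubd i (nat_of_ord i) = i by exact: valKd.
  rewrite ffunE eqxx mulrA.
  congr (_ * _ * _); apply: eq_big_nat => j /andP[H1 H2]; rewrite ffunE.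
    by rewrite -val_eqE val_insubd (ltn_trans H2) // ltn_eqF.
  by rewrite -val_eqE val_insubd H2 gtn_eqF.
by rewrite !E mulrDr mulrDl -scalerAr -scalerAl.
Qed.

Lemma pure_tbasis (f g : {ffun 'I_r -> 'I_n}) : pure (tbasis f) g = (f == g)%:R.
Proof.
rewrite ffunE; have [<-|/eqP ne] := eqVneq.
  by apply: big1 => i _; rewrite ffunE coord_free ?eqxx // (basis_free (vbasisP _)).
have [i nei] : exists i, f i != g i.
  by apply/existsP; rewrite -negb_forall; apply/forallP => H; apply: ne; apply/ffunP=> i; apply/eqP.
rewrite (bigD1 i) //= ffunE coord_free ?(basis_free (vbasisP _)) //.
by have /negPf := nei; rewrite -val_eqE /= => ->; rewrite mul0r.
Qed.

Lemma tlift_pure V (F : {ffun 'I_r -> A} -> V) a :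
  multilinear F -> tlift F (pure a) = F a.
Proof.
move=> Fl; apply: (multilinear_ext (F := fun a => tlift F (pure a))) => // [{}a i c u v|f].
  rewrite /tlift scaler_sumr -big_split /=; apply: eq_bigr => f _.
  by rewrite multilinear_pure !ffunE scalerDl scalerA.
rewrite /tlift (bigD1 f) //= pure_tbasis eqxx scale1r big1 ?addr0 // => g /negPf ne.
by rewrite pure_tbasis eq_sym ne scale0r.
Qed.

Lemma mu_pure a : mu (pure a) = \prod_(i < r) a i.
Proof. exact: tlift_pure multilinear_mu. Qed.

End Multilinear.

Section Grading.

Variable G : grading A.

Lemma gr_bound : (\sum_(i < degree_bound G) G i)%VS = fullv.
Proof. by rewrite /degree_bound; case: ex_minnP => m /eqP. Qed.

Lemma hcomp_mem (i : 'I_(degree_bound G)) a : hcomp i a \in G i.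
Proof. exact: memv_sum_pi. Qed.

Lemma hcomp_sum a : \sum_i hcomp (G := G) i a = a.
Proof. by rewrite sumv_pi_sum ?gr_bound ?memvf. Qed.

Lemma hcomp_homog (i j : 'I_(degree_bound G)) a :
  a \in G j -> hcomp i a = if i == j then a else 0.
Proof.
move=> aj; have /directv_sum_unique E := gr_direct G (degree_bound G).
pose v (l : 'I_(degree_bound G)) := if l == j then a else 0.
have vG l : true -> v l \in G l by rewrite /v; case: eqP => [->|]; rewrite ?mem0v.
have := E (fun l => hcomp l a) v (fun l _ => hcomp_mem l a) vG.
rewrite hcomp_sum /v -big_mkcond /= big_pred1_eq eqxx => /esym/forall_inP H.
exact/eqP/H.
Qed.

Lemma gr_lt_bound j a : a \in G j -> a != 0 -> (j < degree_bound G)%N.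
Proof.
move=> aj; apply: contraR; rewrite -leqNgt => leNj.
pose N := degree_bound G.
have /directv_sum_independent E := gr_direct G j.+1.
pose u (l : 'I_j.+1) : A :=
  (if (l < N)%N then if insub (val l) is Some l' then hcomp (G := G) l' a else 0 else 0) -
  (if l == j :> nat then a else 0).
have uG l : true -> u l \in G l.
  rewrite /u => _; apply: memvB; last by case: eqP => [->|]; rewrite ?mem0v.
  case: ifP => [lt_l|]; rewrite ?mem0v // insubT; exact: (@hcomp_mem (Sub (val l) lt_l)).
have su : \sum_l u l = 0.
  rewrite sumrB -!big_mkcond /=; apply/eqP; rewrite subr_eq0; apply/eqP.
  rewrite [RHS](big_pred1 ord_max) => [|l]; last by rewrite /= -val_eqE.
  rewrite -[RHS]hcomp_sum -/N.
  rewrite -(big_ord_widen_cond j.+1 xpredT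
    (fun l => if insub l is Some l' then hcomp (G := G) l' a else 0)) //; last exact: leqW.
  by apply: eq_bigr => l _; rewrite valK.
have /(_ ord_max isT) := E u uG su.
rewrite /u /= eqxx ltnNge leNj /= sub0r => /eqP; rewrite oppr_eq0.
by move/eqP->.
Qed.

Variable r : nat.
Implicit Types (a b : {ffun 'I_r -> A}).

Lemma multilinear0 (V : lmodType k) (F : {ffun 'I_r -> A} -> V) a i :
  multilinear F -> a i = 0 -> F a = 0.
Proof.
move=> Fl ai0; rewrite -(upd_id a i) ai0.
have := @multilinear_sum r V F a i nat [::] (fun _ => 0) (fun _ => 0) Fl.
by rewrite !big_nil.
Qed.

Lemma hcompP (l : 'I_(degree_bound G)) c u v :
  hcomp l (c *: u + v) = c *: hcomp l u + hcomp (G := G) l v.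
Proof. exact: linearP. Qed.

Lemma multilinear_pure_mulr a : multilinear (pure_mul G a).
Proof.
move=> b i c u v; rewrite /pure_mul scaler_sumr -big_split; apply: eq_bigr => d _ /=.
rewrite scaler_sumr -big_split; apply: eq_bigr => e _ /=.
have E w : [ffun j => hcomp (d j) (a j) * hcomp (e j) (upd b i w j)] =
  upd [ffun j => hcomp (d j) (a j) * hcomp (e j) (b j)] i
      (hcomp (d i) (a i) * hcomp (e i) w).
  by apply/ffunP=> j; rewrite !ffunE; case: eqP => [->|].
rewrite !E hcompP mulrDr -scalerAr multilinear_pure scalerDr.
by rewrite !scalerA [c * _]mulrC.
Qed.

Lemma multilinear_pure_mull b : multilinear (fun a => pure_mul G a b).
Proof.
move=> a i c u v; rewrite /pure_mul scaler_sumr -big_split; apply: eq_bigr => d _ /=.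
rewrite scaler_sumr -big_split; apply: eq_bigr => e _ /=.
have E w : [ffun j => hcomp (d j) (upd a i w j) * hcomp (e j) (b j)] =
  upd [ffun j => hcomp (d j) (a j) * hcomp (e j) (b j)] i
      (hcomp (d i) w * hcomp (e i) (b i)).
  by apply/ffunP=> j; rewrite !ffunE; case: eqP => [->|].
rewrite !E hcompP mulrDl -scalerAl multilinear_pure scalerDr.
by rewrite !scalerA [c * _]mulrC.
Qed.

Lemma tmul_pureE a b : tmul G (pure a) (pure b) = pure_mul G a b.
Proof.
rewrite /tmul (tlift_pure (F := fun a => tlift (fun b => pure_mul G a b) (pure b))).
  exact/tlift_pure/multilinear_pure_mulr.
move=> {}a i c u v; rewrite !(tlift_pure _ (multilinear_pure_mulr _)).
exact: multilinear_pure_mull.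
Qed.

Lemma tmul_pure a b (d e : 'I_r -> nat) :
  (forall i, a i \in G (d i)) -> (forall i, b i \in G (e i)) ->
  tmul G (pure a) (pure b) = (-1) ^+ koszul d e *: pure [ffun i => a i * b i].
Proof.
move=> aG bG; rewrite tmul_pureE.
have [/existsP[i /eqP ai0]|/existsPn a0] := boolP [exists i, a i == 0].
  rewrite (multilinear0 (multilinear_pure_mull b) ai0).
  by rewrite (multilinear0 (i := i) (@multilinear_pure r)) ?scaler0 // ffunE ai0 mul0r.
have [/existsP[i /eqP bi0]|/existsPn b0] := boolP [exists i, b i == 0].
  rewrite (multilinear0 (multilinear_pure_mulr a) bi0).
  by rewrite (multilinear0 (i := i) (@multilinear_pure r)) ?scaler0 // ffunE bi0 mulr0.
pose d' : {ffun 'I_r -> 'I_(degree_bound G)} :=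
  [ffun i => Ordinal (gr_lt_bound (aG i) (a0 i))].
pose e' : {ffun 'I_r -> 'I_(degree_bound G)} :=
  [ffun i => Ordinal (gr_lt_bound (bG i) (b0 i))].
have aG' i : a i \in G (d' i) by rewrite ffunE.
have bG' i : b i \in G (e' i) by rewrite ffunE.
have neqf (f g : {ffun 'I_r -> 'I_(degree_bound G)}) : f != g -> exists i, f i != g i.
  move=> ne; apply/existsP; rewrite -negb_forall; apply: contra ne => /forallP H.
  by apply/eqP/ffunP=> i; apply/eqP.
rewrite /pure_mul (bigD1 d') //= [X in _ + X]big1 ?addr0 => [|f /neqf[i ne]]; last first.
  rewrite big1 // => g _; rewrite (multilinear0 (i := i) (@multilinear_pure r)) ?scaler0 //.
  by rewrite ffunE (hcomp_homog _ (aG' i)) (negPf ne) mul0r.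
rewrite (bigD1 e') //= [X in _ + X]big1 ?addr0 => [|f /neqf[i ne]]; last first.
  rewrite (multilinear0 (i := i) (@multilinear_pure r)) ?scaler0 //.
  by rewrite ffunE (hcomp_homog _ (bG' i)) (negPf ne) mulr0.
congr ((-1) ^+ _ *: pure _).
  by apply: eq_bigr => i _; apply: eq_bigr => j _; rewrite !ffunE.
have aE i : hcomp (d' i) (a i) = a i by rewrite (hcomp_homog _ (aG' i)) eqxx.
have bE i : hcomp (e' i) (b i) = b i by rewrite (hcomp_homog _ (bG' i)) eqxx.
by apply/ffunP=> i; rewrite ffunE aE bE [RHS]ffunE.
Qed.

End Grading.

End TensorPower.

Definition is_zcl (k : fieldType) (A : falgType k) (G : grading A) (r : nat) :
    nat -> Prop :=
  longest_nonzero_product (fun z : @tpow k A r => mu z = 0) (tprod G (r := r)).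

(* Formal power series over Z, as sequences of coefficients. *)
Definition fps_mul (u v : nat -> int) (n : nat) : int :=
  \sum_(i < n.+1) u i * v (n - i)%N.

Definition fps_of_poly (p : {poly int}) (n : nat) : int := p`_n.

(* (1 - x)^{-2}; see inv_sqr_1subX_mul. *)
Definition inv_sqr_1subX (n : nat) : int := n.+1%:Z.

Lemma inv_sqr_1subX_mul :
  fps_mul inv_sqr_1subX (fps_of_poly ((1 - 'X) ^+ 2)) =1 fps_of_poly 1.
Proof.
move=> n; rewrite /fps_mul /fps_of_poly /inv_sqr_1subX.
have E m : ((1 - 'X) ^+ 2 : {poly int})`_m = (m == 0)%:Z - (m == 1)%:Z *+ 2 + (m == 2)%:Z.
  rewrite sqrrB !expr1n mul1r coefD coefB coefMn coef1 coefX coefXn.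
  by case: m => [|[|[|m]]].
under eq_bigr do rewrite E.
case: n => [|[|n]]; rewrite coef1.
- by rewrite big_ord_recl big_ord0.
- by rewrite !big_ord_recl big_ord0.
rewrite 3!big_ord_recr /= big1 => [|i _]; last first.
  have := ltn_ord i; case: i => i /= _ lt_i.
  have -> : (n.+2 - i = (n - i.+1).+3)%N by lia.
  by rewrite /= mul0rn subr0 addr0 mulr0.
have -> : (n.+2 - n = 2)%N by lia.
have -> : (n.+2 - n.+1 = 1)%N by lia.
by rewrite subnn; lia.
Qed.

(* Main.v *)
(* The defect r * cl - zcl_r is a nonnegative, nonincreasing sequence of integers,
   hence eventually constant, so that zcl_(r+1) - zcl_r = cl for large r.

   It is nonnegative because, A being connected, every element of ker mu_r is a
   combination of pure tensors of positive-degree monomials with at least one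
   factor in total: a product of m of them has m factors spread over r slots, so
   it vanishes for m > r * cl.

   It is nonincreasing because a product Z of elements of ker mu_r and a nonzero
   product a_1 ... a_c in A give, after adding a slot on the left, the elements
   a_i⊗1 - 1⊗a_i⊗1 and 1⊗z of ker mu_(r+1), whose product is a_1 ... a_c ⊗ Z plus
   terms of lower degree in the new slot. *)
Require Import Defs.
From mathcomp Require Import all_boot all_order all_algebra all_field.
From mathcomp Require Import zify.
From Stdlib Require Import Classical IndefiniteDescription.
Import GRing.Theory.
Local Open Scope ring_scope.

Set Implicit Arguments.
Unset Strict Implicit.
Unset Printing Implicit Defensive.

(** * Linear spans of arbitrary predicates *)

Section Spanned.

Context {k : fieldType}.

(** The linear span of a possibly infinite family, given inductively so that a linear statement is
    checked by adding one generator at a time. *)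
Inductive spanned (V : lmodType k) (B : V -> Prop) : V -> Prop :=
| spanned0 : spanned B 0
| spannedS c u v : B u -> spanned B v -> spanned B (c *: u + v).

Lemma spannedP (V : lmodType k) (B : V -> Prop) c u v :
  spanned B u -> spanned B v -> spanned B (c *: u + v).
Proof.
move=> Bu Bv; elim: Bu => [|d w u' Bw _ IH]; first by rewrite scaler0 add0r.
by rewrite scalerDr scalerA -addrA; apply: spannedS.
Qed.

Lemma spanned_mem (V : lmodType k) (B : V -> Prop) u : B u -> spanned B u.
Proof. by move=> Bu; rewrite -[u]addr0 -[u]scale1r; apply: spannedS (spanned0 _). Qed.

Lemma spannedZ (V : lmodType k) (B : V -> Prop) c u : spanned B u -> spanned B (c *: u).
Proof. by move=> Bu; rewrite -[_ *: _]addr0; apply: spannedP => //; apply: spanned0. Qed.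

Lemma spannedD (V : lmodType k) (B : V -> Prop) u v :
  spanned B u -> spanned B v -> spanned B (u + v).
Proof. by move=> Bu Bv; rewrite -[u]scale1r; apply: spannedP Bv. Qed.

Lemma spannedB (V : lmodType k) (B : V -> Prop) u v :
  spanned B u -> spanned B v -> spanned B (u - v).
Proof. by move=> Bu Bv; rewrite addrC -scaleN1r; apply: spannedP. Qed.

Lemma spanned_sum (V : lmodType k) (B : V -> Prop) (I : Type) (s : seq I) (F : I -> V) :
  (forall i, spanned B (F i)) -> spanned B (\sum_(i <- s) F i).
Proof.
move=> BF; elim: s => [|i s IH]; first by rewrite big_nil; apply: spanned0.
by rewrite big_cons; apply: spannedD.
Qed.

Lemma spanned_map (V W : lmodType k) (f : V -> W) (B : V -> Prop) (C : W -> Prop) u :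
  linear f -> (forall v, B v -> spanned C (f v)) -> spanned B u -> spanned C (f u).
Proof.
move=> fl fB; elim=> [|c v w Bv _ IH]; last by rewrite fl; apply: spannedP IH; apply: fB.
by rewrite -(subrr 0) (GRing.zmod_morphism_linear fl) subrr; apply: spanned0.
Qed.

Lemma spanned_ext (V W : lmodType k) (f g : V -> W) (B : V -> Prop) u :
  linear f -> linear g -> (forall v, B v -> f v = g v) -> spanned B u -> f u = g u.
Proof.
move=> fl gl fg Bu; apply/eqP; rewrite -subr_eq0; apply/eqP.
(* The span of the predicate [w = 0] is zero, so it suffices that [f - g] maps generators into
   it. *)
suff: spanned (fun w : W => w = 0) (f u - g u).
  by elim=> [|c x v -> _ ->] //; rewrite scaler0 addr0.
apply: (spanned_map (f := fun u => f u - g u) _ _ Bu) => [c x y|v Bv].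
  by rewrite fl gl scalerBr opprD addrACA.
by apply: spanned_mem; rewrite fg ?subrr.
Qed.

End Spanned.

(** * Bilinearity of [tmul] and homogeneous pure tensors *)

Section TensorPower.

Context {k : fieldType} {A : falgType k}.
Variable G : grading A.
Implicit Types (r : nat) (a b : A).

Lemma tlift_linear r (V : lmodType k) (F : {ffun 'I_r -> A} -> V) : linear (tlift F).
Proof.
move=> c x y; rewrite /tlift scaler_sumr -big_split /=; apply: eq_bigr => f _.
by rewrite !ffunE scalerDl scalerA.
Qed.

Lemma tmul_linearl r (y : tpow r) : linear (fun x => tmul G x y).
Proof. exact: tlift_linear. Qed.

Lemma tmul_linearr r (x : tpow r) : linear (tmul G x).
Proof.
move=> c y z; rewrite /tmul /tlift scaler_sumr -big_split /=; apply: eq_bigr => f _.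
rewrite -/(tlift _ _) -/(tlift _ y) -/(tlift _ z) tlift_linear scalerDr.
by rewrite !scalerA [_ * c]mulrC.
Qed.

Lemma tmulBl r (y x x' : tpow r) : tmul G (x - x') y = tmul G x y - tmul G x' y.
Proof. exact: GRing.zmod_morphism_linear (tmul_linearl y) x x'. Qed.

Lemma tmulBr r (x y y' : tpow r) : tmul G x (y - y') = tmul G x y - tmul G x y'.
Proof. exact: GRing.zmod_morphism_linear (tmul_linearr x) y y'. Qed.

Definition hpure r (t : tpow r) : Prop :=
  exists (a : {ffun 'I_r -> A}) (d : {ffun 'I_r -> nat}), (forall i, a i \in G (d i)) /\ t = pure a.

(** Basis tensors span; splitting every slot into homogeneous components and distributing the
    product of coordinates reduces them to tensors to which the sign rule applies. *)
Lemma hpure_span r (t : tpow r) : spanned (@hpure r) t.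
Proof.
have -> : t = \sum_f (t f : k) *: pure (tbasis f).
  apply/ffunP=> g; rewrite sum_ffunE (bigD1 g) //= ffunE pure_tbasis eqxx.
  rewrite [_ *: _]mulr1 big1 ?addr0 // => f /negPf ne.
  by rewrite ffunE pure_tbasis ne [_ *: _]mulr0.
apply: spanned_sum => f; apply: spannedZ; move: (tbasis f) => a.
have -> : pure a = \sum_(d : {ffun 'I_r -> 'I_(degree_bound G)}) pure [ffun i => hcomp (d i) (a i)].
  apply/ffunP=> g; rewrite sum_ffunE ffunE.
  under eq_bigr => i _ do rewrite -{1}(hcomp_sum G (a i)) linear_sum.
  rewrite bigA_distr_bigA /=; apply: eq_bigr => d _; rewrite ffunE.
  by apply: eq_bigr => i _; rewrite ffunE.
apply: spanned_sum => d; apply: spanned_mem.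
exists [ffun i => hcomp (d i) (a i)], [ffun i => val (d i)].
by split=> // i; rewrite !ffunE hcomp_mem.
Qed.

Lemma hpure_ext r (V : lmodType k) (f g : tpow r -> V) :
  linear f -> linear g -> (forall t, hpure t -> f t = g t) -> f =1 g.
Proof. by move=> fl gl fg t; apply: (spanned_ext fl gl fg); apply: hpure_span. Qed.

Lemma mu_tone r : mu (tone r) = 1 :> A.
Proof. by rewrite mu_pure big1 // => i _; rewrite ffunE. Qed.

Lemma tone_neq0 r : tone r != 0 :> @tpow k A r.
Proof.
apply/eqP=> t0; have := mu_tone r; rewrite t0 /mu /tlift big1 => [/eqP|f _].
  by rewrite eq_sym oner_eq0.
by rewrite ffunE scale0r.
Qed.

(** * Adding a slot on the left of a tensor *)

Definition fcons r (T : Type) (b : T) (a : {ffun 'I_r -> T}) : {ffun 'I_r.+1 -> T} :=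
  [ffun i => if unlift ord0 i is Some j then a j else b].

Lemma fcons0 r (T : Type) (b : T) (a : {ffun 'I_r -> T}) : fcons b a ord0 = b.
Proof. by rewrite ffunE unlift_none. Qed.

Lemma fconsS r (T : Type) (b : T) (a : {ffun 'I_r -> T}) i : fcons b a (lift ord0 i) = a i.
Proof. by rewrite ffunE liftK. Qed.

Lemma fcons_upd r b (a : {ffun 'I_r -> A}) i c :
  fcons b (upd a i c) = upd (fcons b a) (lift ord0 i) c.
Proof.
apply/ffunP=> j; rewrite [RHS]ffunE; case: (unliftP ord0 j) => [l|] ->.
  by rewrite !fconsS ffunE (inj_eq lift_inj).
by rewrite !fcons0 (negPf (neq_lift _ _)).
Qed.

Definition tcons r b : tpow r -> tpow r.+1 :=
  tlift (fun a : {ffun 'I_r -> A} => pure (fcons b a)).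

Lemma tcons_linear r b : linear (@tcons r b).
Proof. exact: tlift_linear. Qed.

Lemma tcons_pure r b (a : {ffun 'I_r -> A}) : tcons b (pure a) = pure (fcons b a).
Proof.
apply: tlift_pure => {}a i c u v /=.
by rewrite !fcons_upd multilinear_pure.
Qed.

Lemma mu_tcons r b (t : tpow r) : mu (tcons b t) = b * mu t.
Proof.
apply: (hpure_ext (f := fun t => mu (tcons b t)) (g := fun t => b * mu t)).
- by move=> c x y; rewrite tcons_linear /mu tlift_linear.
- by move=> c x y; rewrite /mu tlift_linear mulrDr scalerAr.
- move=> _ [a [d [aG ->]]]; rewrite tcons_pure !mu_pure big_ord_recl fcons0.
  by congr (_ * _); apply: eq_bigr => i _; rewrite fconsS.
Qed.

Lemma tone_tcons r : tone r.+1 = tcons 1 (tone r) :> @tpow k A _.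
Proof.
rewrite tcons_pure; congr pure; apply/ffunP=> i.
by case: (unliftP ord0 i) => [j|] ->; rewrite ?fconsS ?fcons0 !ffunE.
Qed.

Lemma fcons_mem r b n (a : {ffun 'I_r -> A}) (d : {ffun 'I_r -> nat}) :
  b \in G n -> (forall i, a i \in G (d i)) -> forall i, fcons b a i \in G (fcons n d i).
Proof. by move=> bG aG i; case: (unliftP ord0 i) => [j|] ->; rewrite ?fconsS ?fcons0. Qed.

(* The new slot being leftmost, its own degree m in the left factor costs no sign. *)
Lemma koszul_fcons r m n (d e : {ffun 'I_r -> nat}) :
  koszul (fcons m d) (fcons n e) = (koszul d e + \sum_i d i * n)%N.
Proof.
rewrite /koszul big_ord_recl addnC; congr (_ + _)%N.
  apply: eq_bigr => i _; rewrite big_mkcond big_ord_recl /= add0n -big_mkcond /=.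
  by apply: eq_big => j; rewrite ?fconsS //.
rewrite big_mkcond big_ord_recl /= add0n.
by apply: eq_bigr => j _; rewrite fconsS fcons0.
Qed.

Lemma fcons_mul r a b (x y : {ffun 'I_r -> A}) :
  [ffun i => fcons a x i * fcons b y i] = fcons (a * b) [ffun i => x i * y i].
Proof.
by apply/ffunP=> i; rewrite ffunE; case: (unliftP ord0 i) => [j|] ->;
  rewrite ?fconsS ?fcons0 ?ffunE.
Qed.

(** The extra sign comes from moving [b], of degree [j], leftwards past all the slots of [x]. *)
Lemma tmul_tcons_pure r a b i j (x y : {ffun 'I_r -> A}) (d e : {ffun 'I_r -> nat}) :
  a \in G i -> b \in G j ->
  (forall l, x l \in G (d l)) -> (forall l, y l \in G (e l)) ->
  tmul G (tcons a (pure x)) (tcons b (pure y)) =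
    (-1) ^+ (\sum_l d l * j)%N *: tcons (a * b) (tmul G (pure x) (pure y)).
Proof.
move=> aG bG xG yG; rewrite !tcons_pure.
rewrite (tmul_pure (fcons_mem aG xG) (fcons_mem bG yG)) (tmul_pure xG yG).
rewrite koszul_fcons fcons_mul -tcons_pure addnC exprD -scalerA; congr (_ *: _).
by rewrite (GRing.scalable_linear (@tcons_linear r (a * b))).
Qed.


(** * Number of positive-degree factors, and the bound of zcl_r by r times cl *)

Lemma prod_pos_homog (s : seq A) : (forall a, a \in s -> positive_degree G a) ->
  exists2 d, (size s <= d)%N & \prod_(a <- s) a \in G d.
Proof.
elim: s => [_|a s IH sP]; first by exists 0%N; rewrite // big_nil; apply: gr_one.
have [d sd dG] := IH (fun b bs => sP b (mem_behead (s := a :: s) bs)).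
have [i i0 aG] := sP a (mem_head _ _).
exists (i + d)%N; first by rewrite /= -add1n leq_add.
by rewrite big_cons; apply: gr_mul.
Qed.

(** Here [p] counts the positive-degree factors and [d] is the degree. The scalar lets constants be
    monomials of length 0; [p <= d] turns positive length into positive degree, even when [a] is
    zero. *)
Definition monomial p d a : Prop :=
  [/\ exists s (c : k), [/\ size s = p, forall z, z \in s -> positive_degree G z
        & a = c *: \prod_(z <- s) z], a \in G d & (p <= d)%N].

Lemma monomialM p d a q e b : monomial p d a -> monomial q e b -> monomial (p + q) (d + e) (a * b).
Proof.
move=> [[s [c [<- sP aE]]] aG pd] [[t [c' [<- tP bE]]] bG qe].
split; [|exact: gr_mul|exact: leq_add].
exists (s ++ t), (c' * c); split; first by rewrite size_cat.
  by move=> z; rewrite mem_cat => /orP[/sP|/tP].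
by rewrite aE bE big_cat /= -scalerAl -scalerAr scalerA mulrC.
Qed.

Lemma monomial_eq0 cl p d a : is_cl G cl -> monomial p d a -> (cl < p)%N -> a = 0.
Proof.
move=> [_ clP] [[s [c [<- sP ->]]] _ _] ltp.
have [->|/(clP _ sP)] := eqVneq (\prod_(z <- s) z) 0; first by rewrite scaler0.
by rewrite leqNgt ltp.
Qed.

(** By connectedness an element of degree 0 is a scalar, a monomial without factors; an element of
    positive degree is its own single factor. *)
Lemma homog_monomial d a : connected G -> a \in G d -> monomial (0 < d)%N d a.
Proof.
move=> conn; case: d => [|d] aG; split=> //.
  move: aG; rewrite conn => /vlineP[c ->].
  by exists [::], c; rewrite big_nil.
exists [:: a], 1; split=> // [z|]; last by rewrite big_seq1 scale1r.
by rewrite inE => /eqP ->; exists d.+1.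
Qed.

Definition mon_pure r m (t : tpow r) : Prop :=
  exists (a : {ffun 'I_r -> A}) (p d : {ffun 'I_r -> nat}),
    [/\ forall i, monomial (p i) (d i) (a i), (m <= \sum_i p i)%N & t = pure a].

(** A decreasing filtration of the tensor power by the total number of factors; [weight_geM] makes
    it multiplicative. *)
Definition weight_ge r m (t : tpow r) : Prop := spanned (@mon_pure r m) t.

Lemma weight_geM r m n (x y : tpow r) :
  weight_ge m x -> weight_ge n y -> weight_ge (m + n) (tmul G x y).
Proof.
move=> xW yW.
apply: (spanned_map (tmul_linearl y) _ xW) => _ [a [p [d [aM mp ->]]]].
apply: (spanned_map (@tmul_linearr _ _) _ yW) => _ [b [q [e [bM nq ->]]]].
rewrite (tmul_pure (d := d) (e := e)); [|by move=> i; case: (aM i)|by move=> i; case: (bM i)].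
apply/spannedZ/spanned_mem.
exists [ffun i => a i * b i], [ffun i => p i + q i]%N, [ffun i => d i + e i]%N; split=> // [i|].
  by rewrite !ffunE; apply: monomialM.
by rewrite (eq_bigr (fun i => p i + q i)%N) ?big_split ?leq_add // => i _; rewrite ffunE.
Qed.

(** Pigeonhole: more than [r * cl] factors in [r] slots put more than [cl] of them into one slot,
    whose entry is then zero. *)
Lemma weight_ge0 r cl m (t : tpow r) : is_cl G cl -> weight_ge m t -> (r * cl < m)%N -> t = 0.
Proof.
move=> clP tW ltm; elim: tW => [|c u v [a [p [d [aM mp ->]]]] _ ->] //.
rewrite addr0; have [/existsP[i lti]|/existsPn lep] := boolP [exists i, (cl < p i)%N].
  rewrite (multilinear0 (i := i) (@multilinear_pure _ _ r)) ?scaler0 //.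
  exact: monomial_eq0 clP (aM i) lti.
have := leq_trans ltm mp; rewrite ltnNge -[X in (X * _)%N]card_ord -sum_nat_const.
by rewrite leq_sum // => i _; rewrite leqNgt.
Qed.

Lemma weight_ge_tone r : weight_ge 0 (tone r : tpow r).
Proof.
apply: spanned_mem; exists [ffun=> 1], [ffun=> 0%N], [ffun=> 0%N]; split=> // i.
rewrite !ffunE; split=> //; last exact: gr_one.
by exists [::], 1; split=> //; rewrite big_nil scale1r.
Qed.

(** A homogeneous pure tensor either has a slot of positive degree, hence weight at least 1, or has
    only scalar entries and is a multiple of the unit. *)
Lemma augmentation r (t : tpow r) :
  connected G -> exists c : k, weight_ge 1 (t - c *: tone r).
Proof.
move=> conn; elim: (hpure_span t) => [|c u v [a [d [aG ->]]] _ [e IH]].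
  by exists 0; rewrite scale0r subrr; apply: spanned0.
suff [e' W] : exists c : k, weight_ge 1 (pure a - c *: tone r).
  exists (c * e' + e); rewrite scalerDl -scalerA opprD addrACA -scalerBr.
  exact: spannedP.
have [/existsP[i di]|/existsPn d0] := boolP [exists i, (0 < d i)%N].
  exists 0; rewrite scale0r subr0; apply: spanned_mem.
  exists a, [ffun i => (0 < d i) : nat]%N, d; split=> // [j|].
    by rewrite ffunE; apply: homog_monomial.
  by rewrite (bigD1 i) //= ffunE di.
have /(_ _)/sigW cE i : exists c : k, a i == c *: 1.
  have := aG i; have := d0 i; rewrite -leqNgt leqn0 => /eqP ->; rewrite conn.
  by case/vlineP=> c' ->; exists c'.
exists (\prod_i sval (cE i)); set u' := (X in weight_ge _ X).
suff -> : u' = 0 by apply: spanned0.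
apply/eqP; rewrite subr_eq0; apply/eqP/ffunP=> f.
rewrite !ffunE -[RHS]/(\prod_i sval (cE i) * \prod_i coord (vbasis {:A}) (f i) ([ffun=> 1] i)).
rewrite -big_split /=.
by apply: eq_bigr => i _; rewrite ffunE {1}(eqP (svalP (cE i))) linearZ.
Qed.

Lemma hcomp_ne (i : 'I_(degree_bound G)) j a : a \in G j -> i != j :> nat -> hcomp i a = 0.
Proof.
move=> aG ne; have [->|a0] := eqVneq a 0; first by rewrite /hcomp linear0.
have -> := hcomp_homog (j := Ordinal (gr_lt_bound aG a0)) i aG.
by rewrite -val_eqE (negPf ne).
Qed.

(** Write [z] as [c *: tone r] plus a part of weight at least 1. That part has image in positive
    degrees under [mu], so the degree 0 component of [mu z = 0] is [c]. *)
Lemma mu_ker_weight r (z : tpow r) : connected G -> mu z = 0 -> weight_ge 1 z.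
Proof.
move=> conn z0; have [c W] := augmentation z conn.
suff c0 : c = 0 by move: W; rewrite c0 scale0r subr0.
(* The index of degree 0, which lies below the degree bound because 1 is nonzero. *)
pose i := Ordinal (gr_lt_bound (gr_one G) (oner_neq0 A)).
have : hcomp i (mu (z - c *: tone r)) = 0.
  elim: W => [|e u v [a [p [d [aM mp ->]]]] _ IH].
    by rewrite /mu /tlift big1 => [|f _]; rewrite ?/hcomp ?linear0 // ffunE scale0r.
  rewrite /mu tlift_linear hcompP -/(mu v) IH addr0 -/(mu (pure a)) mu_pure.
  rewrite (hcomp_ne (j := \sum_i d i)) ?scaler0 //=.
    apply: (big_ind2 (fun x m => x \in G m)) => [|x m y m' xG yG|j _].
    - exact: gr_one.
    - exact: gr_mul.
    - by case: (aM j).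
  rewrite eq_sym -lt0n (leq_trans mp) //.
  by apply: leq_sum => j _; case: (aM j).
rewrite /mu addrC -scaleNr tlift_linear hcompP -/(mu z) z0 -/(mu _) mu_tone.
rewrite /hcomp linear0 addr0 -/(hcomp i 1).
rewrite (hcomp_homog (j := i) i (gr_one G)) eqxx => /eqP.
by rewrite scaler_eq0 oner_eq0 orbF oppr_eq0 => /eqP.
Qed.

Lemma weight_ge_tprod r (s : seq (tpow r)) :
  connected G -> (forall z, z \in s -> mu z = 0) -> weight_ge (size s) (tprod G s).
Proof.
move=> conn; elim: s => [_|z s IH sK] /=; first exact: weight_ge_tone.
rewrite -add1n; apply: weight_geM.
  by apply: mu_ker_weight => //; apply: sK; rewrite mem_head.
by apply: IH => y ys; apply: sK; rewrite inE ys orbT.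
Qed.

(** * Leading terms in the new slot, and the growth of zcl_r by at least cl *)

(** No sign appears: [b] only passes units, which have degree 0. *)
Lemma tmul_tconsl r a b i j (W : tpow r) : a \in G i -> b \in G j ->
  tmul G (tcons a (tone r)) (tcons b W) = tcons (a * b) W.
Proof.
move=> aG bG; apply: (hpure_ext (f := fun W => tmul G (tcons a (tone r)) (tcons b W)))
  => [c x y|c x y|].
- by rewrite tcons_linear tmul_linearr.
- exact: tcons_linear.
move=> _ [x [d [xG ->]]].
have oneG (l : 'I_r) : [ffun=> 1 : A] l \in G ([ffun=> 0%N] l) by rewrite !ffunE gr_one.
rewrite (tmul_tcons_pure (d := [ffun=> 0%N]) aG bG oneG xG) big1 => [|l _]; last by rewrite ffunE.
rewrite scale1r (tmul_pure oneG xG) /koszul big1 ?scale1r => [|l _].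
  by congr (tcons _ (pure _)); apply/ffunP=> l; rewrite !ffunE mul1r.
by rewrite big1 // => l' _; rewrite ffunE.
Qed.

Lemma tmul_tcons1 r (x y : tpow r) : tmul G (tcons 1 x) (tcons 1 y) = tcons 1 (tmul G x y).
Proof.
apply: (hpure_ext (f := fun x => tmul G (tcons 1 x) (tcons 1 y))
  (g := fun x => tcons 1 (tmul G x y)) _ _ _ x) => [c u v|c u v|{x} _ [x [d [xG ->]]]].
- by rewrite tcons_linear tmul_linearl.
- by rewrite tmul_linearl tcons_linear.
apply: (hpure_ext (f := fun y => tmul G (tcons 1 (pure x)) (tcons 1 y))
  (g := fun y => tcons 1 (tmul G (pure x) y)) _ _ _ y) => [c u v|c u v|{y} _ [y [e [yG ->]]]].
- by rewrite tcons_linear tmul_linearr.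
- by rewrite tmul_linearr tcons_linear.
rewrite (tmul_tcons_pure (gr_one G) (gr_one G) xG yG) big1 ?scale1r ?mulr1 // => l _.
by rewrite muln0.
Qed.

(** The shape of the lower-order terms: a homogeneous first slot of degree below [D], with anything
    in the other slots. *)
Definition tcons_lt r D (t : tpow r.+1) : Prop :=
  exists d b W, [/\ (d < D)%N, b \in G d & t = tcons b W].

(** Multiplication by 1⊗x changes a homogeneous first slot at most by a sign, so its degree is
    preserved. *)
Lemma tmul_tcons_lt r D (x : tpow r) (t : tpow r.+1) :
  spanned (@tcons_lt r D) t -> spanned (@tcons_lt r D) (tmul G (tcons 1 x) t).
Proof.
move=> tS; apply: (spanned_map (@tmul_linearr _ _) _ tS) => _ [j [b [W [ltj bG ->]]]].
apply: (spanned_map (f := fun x => tmul G (tcons 1 x) (tcons b W)) _ _ (hpure_span x))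
  => [c u v|{x} _ [x [d [xG ->]]]].
  by rewrite tcons_linear tmul_linearl.
apply: (spanned_map (f := fun W => tmul G (tcons 1 (pure x)) (tcons b W)) _ _ (hpure_span W))
  => [c u v|{W} _ [y [e [yG ->]]]].
  by rewrite tcons_linear tmul_linearr.
rewrite (tmul_tcons_pure (gr_one G) bG xG yG) mul1r.
by apply/spannedZ/spanned_mem; exists j, b, (tmul G (pure x) (pure y)).
Qed.

(* phi ⊗ id *)
Definition contract r (phi : A -> k) : tpow r.+1 -> tpow r :=
  tlift (fun a : {ffun 'I_r.+1 -> A} => phi (a ord0) *: pure [ffun i => a (lift ord0 i)]).

Lemma contract_tcons r (phi : A -> k) b (W : tpow r) :
  scalar phi -> contract phi (tcons b W) = phi b *: W.
Proof.
move=> phil; apply: (hpure_ext (f := fun W => contract phi (tcons b W))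
  (g := fun W => phi b *: W) _ _ _ W) => [c u v|c u v|{W} _ [a [d [aG ->]]]].
- by rewrite tcons_linear /contract tlift_linear.
- by rewrite scalerDr !scalerA mulrC.
rewrite tcons_pure /contract tlift_pure.
  by rewrite fcons0; congr (_ *: pure _); apply/ffunP=> i; rewrite ffunE fconsS.
move=> {aG d b}a i c u v; case: (unliftP ord0 i) => [j|] ->.
  have E w : [ffun l => upd a (lift ord0 j) w (lift ord0 l)] = upd [ffun l => a (lift ord0 l)] j w.
    by apply/ffunP=> l; rewrite !ffunE (inj_eq lift_inj).
  have E0 w : upd a (lift ord0 j) w ord0 = a ord0 by rewrite ffunE (negPf (neq_lift _ _)).
  by rewrite !E !E0 multilinear_pure scalerDr !scalerA (mulrC c).
have E w : [ffun l => upd a ord0 w (lift ord0 l)] = [ffun l => a (lift ord0 l)].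
  by apply/ffunP=> l; rewrite !ffunE eq_sym (negPf (neq_lift _ _)).
by rewrite !E !ffunE eqxx phil scalerDl scalerA.
Qed.

(** The zero-divisor a⊗1⊗1⊗... - 1⊗a⊗1⊗...; the index [r.+2] guarantees the second slot. *)
Definition slot_diff r a : tpow r.+2 := tcons a (tone r.+1) - tcons 1 (tcons a (tone r)).

Lemma mu_slot_diff r a : mu (slot_diff r a) = 0.
Proof.
rewrite /slot_diff addrC -scaleN1r /mu tlift_linear -!/(mu _) !mu_tcons !mu_tone.
by rewrite mul1r scaleN1r addNr.
Qed.

(** Induction on [s]: in each new factor the term with [a] in the first slot carries the leading
    term along, while the term with [a] in the second slot leaves the first-slot degree behind. *)
Lemma slot_diff_lead r (s : seq A) (Z : tpow r.+1) :
  (forall a, a \in s -> positive_degree G a) ->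
  exists2 D, \prod_(a <- s) a \in G D &
    spanned (@tcons_lt r.+1 D)
      (foldr (tmul G (r := r.+2)) (tcons 1 Z) (map (@slot_diff r) s)
       - tcons (\prod_(a <- s) a) Z).
Proof.
elim: s => [_|a s IH sP].
  exists 0%N; rewrite big_nil ?gr_one //= subrr; exact: spanned0.
have [D DG S] := IH (fun b bs => sP b (mem_behead (s := a :: s) bs)).
have [i i0 aG] := sP a (mem_head _ _).
exists (i + D)%N; rewrite big_cons; first exact: gr_mul.
rewrite /=; move: (foldr _ _ _) (\prod_(b <- s) b) DG S => t b bG S.
have up (u : tpow r.+2) : spanned (@tcons_lt r.+1 D) u -> spanned (@tcons_lt r.+1 (i + D)) u.
  apply: (spanned_map (f := id)) => // v [d [c [W [dD cG ->]]]]; apply: spanned_mem.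
  by exists d, c, W; split=> //; rewrite ltn_addl.
(* Positivity of the degree [i] of [a] enters here: the previous leading term, of degree [D], is
   below [i + D]. *)
have low : spanned (@tcons_lt r.+1 (i + D)) (tcons b Z).
  by apply: spanned_mem; exists D, b, Z; split=> //; rewrite -[X in (X < _)%N]add0n ltn_add2r.
have tE : t = (t - tcons b Z) + tcons b Z by rewrite subrK.
have S1 : spanned (@tcons_lt r.+1 (i + D)) (tmul G (tcons a (tone r.+1)) (t - tcons b Z)).
  apply: (spanned_map (@tmul_linearr _ _) _ S) => _ [d [c [W [dD cG ->]]]].
  rewrite (tmul_tconsl _ aG cG); apply: spanned_mem; exists (i + d)%N, (a * c), W.
  by split=> //; [rewrite ltn_add2l | apply: gr_mul].
have S2 : spanned (@tcons_lt r.+1 (i + D)) (tmul G (tcons 1 (tcons a (tone r))) t).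
  by apply: tmul_tcons_lt; rewrite tE; apply: spannedD low; apply: up.
have -> : tmul G (slot_diff r a) t - tcons (a * b) Z =
    tmul G (tcons a (tone r.+1)) (t - tcons b Z) - tmul G (tcons 1 (tcons a (tone r))) t.
  rewrite /slot_diff -(tmul_tconsl Z aG bG).
  by rewrite (tmulBl t) (tmulBr _ t) addrAC.
exact: spannedB.
Qed.

(** The leading term [tcons b Z], with [b] the product of [s] and [Z] that of [zs], cannot be
    cancelled: a functional on the first slot kills all lower terms but not [b]. *)
Lemma zcl_witness_step r (s : seq A) (zs : seq (tpow r.+1)) :
  (forall a, a \in s -> positive_degree G a) -> \prod_(a <- s) a != 0 ->
  (forall z, z \in zs -> mu z = 0) -> tprod G zs != 0 ->
  exists zs' : seq (tpow r.+2), [/\ size zs' = (size zs + size s)%N,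
    forall z, z \in zs' -> mu z = 0 & tprod G zs' != 0].
Proof.
move=> sP s0 zP z0; exists (map (@slot_diff r) s ++ map (@tcons r.+1 1) zs); split.
- by rewrite size_cat !size_map addnC.
- move=> z; rewrite mem_cat => /orP[]/mapP[x xs ->]; first exact: mu_slot_diff.
  by rewrite mu_tcons (zP x xs) mulr0.
have E : tprod G (map (@tcons r.+1 1) zs) = tcons 1 (tprod G zs).
  by elim: zs {zP z0} => [|z zs IH] /=; rewrite ?tone_tcons // IH tmul_tcons1.
rewrite /tprod foldr_cat -/(tprod G _) E; move: (tprod G zs) z0 => Z Z0.
have [D bG S] := slot_diff_lead Z sP.
move: (foldr _ _ _) (\prod_(a <- s) a) s0 bG S => t b b0 bG S.
pose i := Ordinal (gr_lt_bound bG b0).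
have [j cj] : exists j, coord (vbasis {:A}) j b != 0.
  apply/existsP; apply: contraNT (b0); rewrite negb_exists => /forallP c0.
  rewrite (coord_vbasis (memvf b)) big1 // => j _.
  by have := c0 j; rewrite negbK => /eqP ->; rewrite scale0r.
(* A coordinate of the component in the degree [D] of [b]: it is nonzero at [b] and zero on every
   homogeneous element of smaller degree. *)
pose phi (x : A) : k := coord (vbasis {:A}) j (hcomp i x).
have phil : scalar phi by move=> c x y; rewrite /phi hcompP linearP.
have phiE : contract phi (t - tcons b Z) = 0.
  elim: S => [|c u v [d [x [W [dD xG ->]]]] _ IH].
    by rewrite /contract /tlift big1 // => f _; rewrite ffunE scale0r.
  rewrite /contract tlift_linear -!/(contract _ _) IH contract_tcons //.
  by rewrite /phi (hcomp_ne (i := i) xG) ?linear0 ?scale0r ?scaler0 ?addr0 //= gtn_eqF.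
(* If the product [t] vanished, contracting with [phi] would leave [phi b *: Z = 0]. *)
apply: contraNneq Z0 => t0; move: phiE.
rewrite t0 sub0r -scaleN1r /contract (GRing.scalable_linear (tlift_linear _)) -/(contract _ _) /=.
rewrite contract_tcons // /phi (hcomp_homog (j := i) i bG) eqxx scaleN1r => /eqP.
by rewrite oppr_eq0 scaler_eq0 (negPf cj).
Qed.

End TensorPower.

(** * Existence of maxima, eventually constant sequences and rational generating functions *)

Lemma ex_max_bounded (P : nat -> Prop) M : P 0%N -> (forall m, P m -> (m <= M)%N) ->
  exists m, P m /\ forall m', P m' -> (m' <= m)%N.
Proof.
move=> P0; elim: M => [|M IH] PM; first by exists 0%N.
have [PM1|nPM1] := classic (P M.+1); first by exists M.+1.
apply: IH => m Pm; have := PM m Pm; rewrite leq_eqVlt => /orP[/eqP mE|//].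
by case: nPM1; rewrite -mE.
Qed.

Lemma longest_ex (T : nmodType) (K : T -> Prop) (prod : seq T -> T) M :
  prod [::] != 0 ->
  (forall s, (forall z, z \in s -> K z) -> prod s != 0 -> (size s <= M)%N) ->
  exists m, longest_nonzero_product K prod m.
Proof.
move=> p0 pM.
have [||m [Pm mP]] := @ex_max_bounded (fun m => exists s : seq T,
     [/\ size s = m, forall z, z \in s -> K z & prod s != 0]) M.
- by exists [::].
- by move=> _ [s [<- sK s0]]; apply: pM.
by exists m; split=> // s sK s0; apply: mP; exists s.
Qed.

Lemma eventually_constant (e : nat -> nat) n0 :
  (forall n, (n0 <= n)%N -> (e n.+1 <= e n)%N) ->
  exists N, forall n, (N <= n)%N -> e n.+1 = e n.
Proof.
(* Induction on an upper bound for [e n0], with the starting point [n0] left free: each strict drop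
   restarts the argument with a smaller bound. *)
elim: (e n0) {-2}n0 (leqnn (e n0)) => {n0} [|m IH] n0 en0 de.
  have e0 n : (n0 <= n)%N -> e n = 0%N.
    elim: n => [|n IHn]; first by rewrite leqn0 => /eqP n00; move: en0; rewrite n00 leqn0 => /eqP.
    rewrite leq_eqVlt => /orP[/eqP <-|lt]; first by apply/eqP; rewrite -leqn0.
    by apply/eqP; rewrite -leqn0 -(IHn lt) de.
  by exists n0 => n n0n; rewrite !e0 // leqW.
have [[n [n0n lt]]|H] := classic (exists n, (n0 <= n)%N /\ (e n.+1 < e n)%N).
  apply: (IH n.+1) => [|n' n'n]; last by apply: de; apply: leq_trans n'n; apply: leqW.
  have en : (e n <= e n0)%N.
    elim: n n0n {lt} => [|n IHn]; first by rewrite leqn0 => /eqP ->.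
    rewrite leq_eqVlt => /orP[/eqP <- //|lt]; exact: leq_trans (de _ lt) (IHn lt).
  by rewrite -ltnS (leq_trans lt) // (leq_trans en).
exists n0 => n n0n; apply/eqP; rewrite eqn_leq de //= leqNgt.
by apply/negP=> lt; apply: H; exists n.
Qed.

Lemma eventually_linear_rational (f : nat -> int) (c : int) N : f 0%N = 0 ->
  (forall n, (N <= n)%N -> f n.+1 = f n + c) ->
  exists P : {poly int}, f =1 fps_mul (fps_of_poly P) inv_sqr_1subX /\ P.[1] = c.
Proof.
move=> f0 fN.
(* First and second differences, with value 0 at index 0 because [f 0 = 0]; [p] lists the
   coefficients of (1-x)^2 times the series of [f]. *)
pose g n := if n is m.+1 then f m.+1 - f m else 0.
pose p n := if n is m.+1 then g m.+1 - g m else 0.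
have sum_p n : \sum_(i < n.+1) p i = g n.
  elim: n => [|n IH]; first by rewrite big_ord1.
  by rewrite big_ord_recr IH /= addrC subrK.
have pN n : (N.+2 <= n)%N -> p n = 0.
  case: n => [|[|n]] //; rewrite !ltnS => Nn.
  by rewrite /p /g (fN n.+1) ?leqW // fN //; lia.
exists (\poly_(i < N.+2) p i).
have pE n : (\poly_(i < N.+2) p i)`_n = p n.
  by rewrite coef_poly; case: ltnP => // /pN.
split=> [n|].
  rewrite /fps_mul /fps_of_poly /inv_sqr_1subX.
  under eq_bigr do rewrite pE.
  elim: n => [|n IH]; first by rewrite big_ord1 mul0r.
  rewrite big_ord_recr /= subnn mulr1.
  (* Passing from [n] to [n.+1] raises each weight by one, which adds the partial sum [g n]; the
     last term [p n.+1] completes it to [g n.+1]. *)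
  have -> : \sum_(i < n.+1) p i * (n.+1 - i).+1%:Z =
      \sum_(i < n.+1) p i * (n - i).+1%:Z + \sum_(i < n.+1) p i.
    rewrite -big_split; apply: eq_bigr => i _ /=.
    by rewrite (subSn (ltnSE (ltn_ord i))) -[(n - i).+2]addn1 PoszD mulrDr mulr1.
  by rewrite -IH -addrA sum_p /=; lia.
rewrite horner_poly; under eq_bigr do rewrite expr1n mulr1.
(* The value at 1 is the sum of all [p i], which telescopes to [g N.+1], the eventual increment. *)
by rewrite sum_p /g fN // addrC addKr.
Qed.

Theorem lemma2 (k : fieldType) (A : falgType k) (G : grading A)
    (hcomm : graded_commutative G) (hconn : connected G) :
  exists (cl : nat) (zcl : nat -> nat),
    [/\ is_cl G cl,
        forall r : nat, (2 <= r)%N -> is_zcl G r (zcl r)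
      & exists P : {poly int},
          (fun r : nat => if (1 <= r)%N then (zcl r.+1)%:Z else 0)
            =1 fps_mul (fps_of_poly P) inv_sqr_1subX
          /\ P.[1] = cl%:Z].
Proof.
have [|s sP s0|cl clP] := longest_ex (K := positive_degree G)
    (prod := fun s => \prod_(a <- s) a) (M := degree_bound G).
- by rewrite big_nil oner_neq0.
- have [d sd dG] := prod_pos_homog sP.
  (* A nonzero product of n positive-degree elements has degree at least n, and this degree is below
     the bound. *)
  exact: leq_trans sd (ltnW (gr_lt_bound dG s0)).
have zcl_le r (s : seq (@tpow k A r)) :
    (forall z, z \in s -> mu z = 0) -> tprod G s != 0 -> (size s <= r * cl)%N.
  move=> sK; apply: contraNT; rewrite -ltnNge => /(weight_ge0 clP (weight_ge_tprod hconn sK)).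
  by move/eqP.
have [zcl zclP] : exists zcl, forall r, is_zcl G r (zcl r).
  apply: functional_choice => r.
  by apply: (longest_ex _ (@zcl_le r)); apply: tone_neq0.
exists cl, zcl; split=> //.
(* At least one old slot is required to hold the second term of each [slot_diff], hence the start at
   [r.+1]. *)
have step r : (zcl r.+1 + cl <= zcl r.+2)%N.
  have [[zs [<- zsK zs0]] _] := zclP r.+1.
  have [[s [<- sP s0]] _] := clP.
  have [zs' [<- zs'K zs'0]] := zcl_witness_step sP s0 zsK zs0.
  by have [_] := zclP r.+2; apply.
have le r : (zcl r <= r * cl)%N.
  by have [[zs [<- zsK zs0]] _] := zclP r; apply: zcl_le.
(* The defect; by [le] the truncated subtraction is exact. Monotonicity is available from index 1
   on, by [step]. *)
have [|N NP] := @eventually_constant (fun r => r * cl - zcl r)%N 1.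
  by case=> // r _; have := step r; rewrite mulSn; lia.
(* The threshold [N.+1] is positive, which keeps the default coefficient 0 at index 0 out of the
   recurrence. *)
apply: (@eventually_linear_rational _ _ N.+1) => //= -[|n] //= ltNn.
have := NP n.+2; rewrite leqW ?(ltnW ltNn) // => /(_ isT).
have := le n.+2; have := le n.+3; rewrite [(n.+3 * _)%N]mulSn; lia.
Qed.
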